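(* If $X$ is a DMGrp-space, then $\mathcal{G}_0(X)=\langle\Omega(X);\cap,\cup,{}^{*},\circ,\rightarrow,\Theta,\emptyset,X\rangle$ is a De Morgan groupoid.
   Context: A De Morgan algebra is a bounded distributive lattice $\langle A;\wedge,\vee,0,1\rangle$ with a unary operation $-$ such that $a\leq b$ implies $-b\leq -a$, and $--a=a$. A De Morgan groupoid is an algebra $\langle A;\wedge,\vee,-,\cdot,\rightarrow,t,0,1\rangle$ such that $\langle A;\wedge,\vee,-,0,1\rangle$ is a De Morgan algebra and, for all $a,b,c\in A$: $t\cdot a=a$; $a\cdot 0=0\cdot a=0$; $a\cdot(b\vee c)=(a\cdot b)\vee(a\cdot c)$; $(a\vee b)\cdot c=(a\cdot c)\vee(b\cdot c)$; and $a\cdot b\leq c$ iff $a\leq b\rightarrow c$. In $\mathcal{G}_0(X)$ the operations $\cap,\cup,{}^*,\circ,\rightarrow,\Theta,\emptyset,X$ interpret $\wedge,\vee,-,\cdot,\rightarrow,t,0,1$. For a topological space $X$, $\Omega(X)$ is the set of compact open subsets of $X$, and the specialization order is: $x\leqslant y$ iff every open set containing $x$ contains $y$. A spectral space is a compact, $T_0$, sober space $X$ such that $\Omega(X)$ is closed under finite intersections and is a basis for $X$ (sober: every completely prime filter of the lattice of open sets is the set of open neighbourhoods of some point). A De Morgan spectral space is $\langle X;g,\tau\rangle$ where $\langle X;\tau\rangle$ is a spectral space, $g\colon X\to X$ is an order-inverting involution for $\leqslant$, and $U^*:=\{x\in X:g(x)\notin U\}\in\Omega(X)$ for every $U\in\Omega(X)$.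 For $S\subseteq X^3$ and $U,V\subseteq X$ let $U\circ V=\{z\in X:\exists x,y\,(Sxyz,\ x\in U,\ y\in V)\}$ and $U\rightarrow V=\{x\in X:\forall y,z\,((Sxyz\ \text{and}\ y\in U)\Rightarrow z\in V)\}$. A DMGrp-space is $\langle X;g,S,\Theta,\tau\rangle$, with $S\subseteq X^3$ and $\Theta\subseteq X$, such that: (1) $\langle X;g,\tau\rangle$ is a De Morgan spectral space; (2) $U,V\in\Omega(X)$ implies $U\circ V\in\Omega(X)$ and $U\rightarrow V\in\Omega(X)$; (3) $Sxyz$, $x'\leqslant x$, $y'\leqslant y$, $z\leqslant z'$ imply $Sx'y'z'$; (4) if not $Sxyz$, there are $U,V\in\Omega(X)$ with $x\in U$, $y\in V$, $z\notin U\circ V$; (5) $\Theta\in\Omega(X)$ and for all $y,z$: $y\leqslant z$ iff there is $x\in\Theta$ with $Sxyz$. *)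

(* Defs.v *)
From mathcomp Require Import all_boot.
From mathcomp Require Import boolp classical_sets topology.

Set Implicit Arguments.
Unset Strict Implicit.
Unset Printing Implicit Defensive.

Local Open Scope classical_set_scope.

(* Raw algebras in the signature (meet, join, neg, mul, imp, t, 0, 1). *)
Record dmg_algebra := DmgAlgebra {
  dmg_carrier :> Type;
  dmg_meet : dmg_carrier -> dmg_carrier -> dmg_carrier;
  dmg_join : dmg_carrier -> dmg_carrier -> dmg_carrier;
  dmg_neg : dmg_carrier -> dmg_carrier;
  dmg_mul : dmg_carrier -> dmg_carrier -> dmg_carrier;
  dmg_imp : dmg_carrier -> dmg_carrier -> dmg_carrier;
  dmg_t : dmg_carrier;
  dmg_bot : dmg_carrier;
  dmg_top : dmg_carrier
}.

Record bounded_distr_lattice (A : Type) (meet join : A -> A -> A)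
    (bot top : A) : Prop := {
  bdl_meetC : commutative meet;
  bdl_joinC : commutative join;
  bdl_meetA : associative meet;
  bdl_joinA : associative join;
  bdl_meetUK : forall a b, meet a (join a b) = a;
  bdl_joinIK : forall a b, join a (meet a b) = a;
  bdl_meetUr : right_distributive meet join;
  bdl_join0 : left_id bot join;
  bdl_meet1 : left_id top meet
}.

Definition lattice_le (A : Type) (meet : A -> A -> A) (a b : A) : Prop :=
  meet a b = a.

Record de_morgan_algebra (A : Type) (meet join : A -> A -> A) (neg : A -> A)
    (bot top : A) : Prop := {
  dma_lattice : bounded_distr_lattice meet join bot top;
  dma_neg_anti : forall a b,
    lattice_le meet a b -> lattice_le meet (neg b) (neg a);
  dma_negK : involutive neg
}.

Record de_morgan_groupoid (A : dmg_algebra) : Prop := {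
  dmg_de_morgan : de_morgan_algebra (@dmg_meet A) (@dmg_join A) (@dmg_neg A)
                    (dmg_bot A) (dmg_top A);
  dmg_mul1 : left_id (dmg_t A) (@dmg_mul A);
  dmg_mulr0 : right_zero (dmg_bot A) (@dmg_mul A);
  dmg_mul0r : left_zero (dmg_bot A) (@dmg_mul A);
  dmg_mulUr : right_distributive (@dmg_mul A) (@dmg_join A);
  dmg_mulUl : left_distributive (@dmg_mul A) (@dmg_join A);
  dmg_residuation : forall a b c : A,
    lattice_le (@dmg_meet A) (dmg_mul a b) c <->
    lattice_le (@dmg_meet A) a (dmg_imp b c)
}.

Definition Omega (X : topologicalType) : set (set X) :=
  [set U | compact U /\ open U].
Arguments Omega : clear implicits.

Definition specialization (X : topologicalType) (x y : X) : Prop :=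
  forall U : set X, open U -> U x -> U y.

(* A filter of the lattice of open sets, so [F] contains only open sets.
   The case of an empty family [G] in [cpf_prime] makes [F] proper. *)
Record completely_prime_filter (X : topologicalType) (F : set (set X)) : Prop := {
  cpf_open : F `<=` open;
  cpf_setT : F [set: X];
  cpf_setI : forall U V, F U -> F V -> F (U `&` V);
  cpf_up : forall U V, F U -> open V -> U `<=` V -> F V;
  cpf_prime : forall G : set (set X), G `<=` open ->
    F (\bigcup_(U in G) U) -> exists2 U, G U & F U
}.

Definition sober (X : topologicalType) : Prop :=
  forall F : set (set X), completely_prime_filter F ->
    exists x : X, F = [set U | open U /\ U x].
Arguments sober : clear implicits.

Record spectral_space (X : topologicalType) : Prop := {
  spectral_compact : compact [set: X];
  spectral_T0 : kolmogorov_space X;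
  spectral_sober : sober X;
  spectral_setI : setI_closed (Omega X);
  spectral_basis : basis (Omega X)
}.
Arguments spectral_space : clear implicits.

Definition involution_star (X : Type) (g : X -> X) (U : set X) : set X :=
  [set x | ~ U (g x)].

Record de_morgan_spectral_space (X : topologicalType) (g : X -> X) : Prop := {
  dms_spectral : spectral_space X;
  dms_g_anti : forall x y, specialization x y -> specialization (g y) (g x);
  dms_gK : involutive g;
  dms_star : forall U, Omega X U -> Omega X (involution_star g U)
}.

Definition rel_mul (X : Type) (S : X -> X -> X -> Prop) (U V : set X) : set X :=
  [set z | exists x y, [/\ S x y z, U x & V y]].

Definition rel_imp (X : Type) (S : X -> X -> X -> Prop) (U V : set X) : set X :=
  [set x | forall y z, S x y z /\ U y -> V z].

Record dmgrp_space (X : topologicalType) (g : X -> X)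
    (S : X -> X -> X -> Prop) (Theta : set X) : Prop := {
  dmgrp_spectral : de_morgan_spectral_space g;
  dmgrp_mul : forall U V, Omega X U -> Omega X V -> Omega X (rel_mul S U V);
  dmgrp_imp : forall U V, Omega X U -> Omega X V -> Omega X (rel_imp S U V);
  dmgrp_mono : forall x y z x' y' z', S x y z ->
    specialization x' x -> specialization y' y -> specialization z z' ->
    S x' y' z';
  dmgrp_sep : forall x y z, ~ S x y z ->
    exists U V, [/\ Omega X U, Omega X V, U x, V y & ~ rel_mul S U V z];
  dmgrp_Theta : Omega X Theta;
  dmgrp_unit : forall y z,
    specialization y z <-> exists2 x, Theta x & S x y z
}.

Lemma Omega_set0 (X : topologicalType) : Omega X set0.
Proof. by split; [exact: compact0 | exact: open0]. Qed.

Lemma Omega_setU (X : topologicalType) (U V : set X) :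
  Omega X U -> Omega X V -> Omega X (U `|` V).
Proof.
by move=> [cU oU] [cV oV]; split; [exact: compactU | exact: openU].
Qed.

Lemma Omega_setT (X : topologicalType) : spectral_space X -> Omega X [set: X].
Proof. by move=> sX; split; [exact: spectral_compact | exact: openT]. Qed.

Definition Omega_el (X : topologicalType) (U : set X) (HU : Omega X U) : Omega X :=
  SigSub (mem_set HU).

Lemma Omega_elP (X : topologicalType) (U : Omega X) : Omega X (val U).
Proof. exact: set_mem (valP U). Qed.

Definition G0 (X : topologicalType) (g : X -> X) (S : X -> X -> X -> Prop)
    (Theta : set X) (H : dmgrp_space g S Theta) : dmg_algebra :=
  let dmX := dmgrp_spectral H in
  let sX := dms_spectral dmX in
  {|
    dmg_carrier := Omega X;
    dmg_meet := fun U V =>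
      Omega_el (spectral_setI sX (Omega_elP U) (Omega_elP V));
    dmg_join := fun U V => Omega_el (Omega_setU (Omega_elP U) (Omega_elP V));
    dmg_neg := fun U => Omega_el (dms_star dmX (Omega_elP U));
    dmg_mul := fun U V => Omega_el (dmgrp_mul H (Omega_elP U) (Omega_elP V));
    dmg_imp := fun U V => Omega_el (dmgrp_imp H (Omega_elP U) (Omega_elP V));
    dmg_t := Omega_el (dmgrp_Theta H);
    dmg_bot := Omega_el (@Omega_set0 X);
    dmg_top := Omega_el (Omega_setT sX)
  |}.

(* Main.v *)
Require Import Defs.
From mathcomp Require Import all_boot.
From mathcomp Require Import boolp classical_sets topology.

Set Implicit Arguments.
Unset Strict Implicit.
Unset Printing Implicit Defensive.

Local Open Scope classical_set_scope.

(** Closure of [Omega X] under the operations is built into [G0], and an element of [Omega X] is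
    determined by its underlying set, so each law becomes an identity or inclusion between subsets
    of [X]. The lattice laws are those of the powerset; [involution_star] is the complement of the
    preimage under [g], hence antitone, and involutive because [g] is. The product [rel_mul] is the
    image of pairs under a ternary relation, so it preserves finite unions, the empty one included,
    in each argument, and [rel_imp] is its residual. The topology enters in the unit law: by
    [dmgrp_unit], multiplying by [Theta] is up-closure for the specialization order, which fixes
    open sets ([rel_mul1]). *)

Lemma lattice_le_setI (T : Type) (A B : set T) :
  lattice_le setI A B <-> A `<=` B.
Proof. exact: setIidPl. Qed.

Lemma involution_starS (X : Type) (g : X -> X) (U V : set X) :
  U `<=` V -> involution_star g V `<=` involution_star g U.
Proof. by move=> UV x nVx /UV. Qed.

(** The two applications of [g] cancel by involutivity, the two complements by classical logic. *)
Lemma involution_starK (X : Type) (g : X -> X) :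
  involutive g -> involutive (involution_star g).
Proof.
move=> gK U; apply/seteqP; split=> x; rewrite /involution_star /= gK.
- exact: contrapT.
- by move=> Ux nUx.
Qed.

Section RelMul.
Variables (X : Type) (S : X -> X -> X -> Prop).
Implicit Types U V W : set X.

Lemma rel_mul_set0 U : rel_mul S U set0 = set0.
Proof. by apply/seteqP; split=> // z [x [y []]]. Qed.

Lemma rel_set0_mul U : rel_mul S set0 U = set0.
Proof. by apply/seteqP; split=> // z [x [y []]]. Qed.

Lemma rel_mulUr U V W :
  rel_mul S U (V `|` W) = rel_mul S U V `|` rel_mul S U W.
Proof.
apply/seteqP; split=> z.
- by move=> [x [y [Sxyz Ux [Vy|Wy]]]]; [left|right]; exists x, y.
- by move=> [] [x [y [Sxyz Ux Vy]]]; exists x, y; split=> //; [left|right].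
Qed.

Lemma rel_mulUl U V W :
  rel_mul S (U `|` V) W = rel_mul S U W `|` rel_mul S V W.
Proof.
apply/seteqP; split=> z.
- by move=> [x [y [Sxyz [Ux|Vx] Wy]]]; [left|right]; exists x, y.
- by move=> [] [x [y [Sxyz Ux Wy]]]; exists x, y; split=> //; [left|right].
Qed.

(** Both sides unfold to the same condition: [S x y z], [U x] and [V y] together force [W z]. *)
Lemma rel_mul_imp U V W : rel_mul S U V `<=` W <-> U `<=` rel_imp S V W.
Proof.
split=> [UVW x Ux y z [Sxyz Vy]|UVW z [x [y [Sxyz Ux Vy]]]].
- by apply: UVW; exists x, y.
- exact: UVW Ux y z (conj Sxyz Vy).
Qed.

End RelMul.

(* Open sets are upward closed for the specialization order. *)
Lemma rel_mul1 (X : topologicalType) (S : X -> X -> X -> Prop)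
    (Theta U : set X) :
  (forall y z, specialization y z <-> exists2 x, Theta x & S x y z) ->
  open U -> rel_mul S Theta U = U.
Proof.
move=> unit oU; apply/seteqP; split=> z.
- move=> [x [y [Sxyz Tx Uy]]].
  have /unit yz : exists2 x, Theta x & S x y z by exists x.
  exact: yz.
- move=> Uz; have /unit[x Tx Sxzz] : specialization z z by [].
  by exists x, z.
Qed.

(** The order of [G0 H] is an equation in a subtype; injectivity of [val] reduces it to an equation
    of sets, so that antitonicity and residuation can be checked on inclusions. *)
Lemma lattice_le_G0 (X : topologicalType) (g : X -> X)
    (S : X -> X -> X -> Prop) (Theta : set X) (H : dmgrp_space g S Theta)
    (U V : G0 H) :
  lattice_le (@dmg_meet (G0 H)) U V <->
  (val (U : Omega X) : set X) `<=` val (V : Omega X).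
Proof.
rewrite -lattice_le_setI; split=> [/(congr1 val)//|UV].
exact: val_inj.
Qed.

Theorem lemma4p8 (X : topologicalType) (g : X -> X)
    (S : X -> X -> X -> Prop) (Theta : set X)
    (H : dmgrp_space g S Theta) :
  de_morgan_groupoid (G0 H).
Proof.
split.
- split.
  + split; repeat move=> ?; apply: val_inj => /=.
    * exact: setIC.
    * exact: setUC.
    * exact: setIA.
    * exact: setUA.
    * by rewrite setIC setUK.
    * by rewrite setUC setIK.
    * exact: setIUr.
    * exact: set0U.
    * exact: setTI.
  + by move=> U V /lattice_le_G0 UV; apply/lattice_le_G0/involution_starS.
  + move=> U; apply: val_inj.
    exact: involution_starK (dms_gK (dmgrp_spectral H)) _.
(* What [rel_mul1] leaves to prove is that [U] is open, one half of membership in [Omega X]. *)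
- move=> U; apply: val_inj; apply: rel_mul1 (dmgrp_unit H) _.
  by have [] := Omega_elP U.
- by move=> U; apply: val_inj; exact: rel_mul_set0.
- by move=> U; apply: val_inj; exact: rel_set0_mul.
- by move=> U V W; apply: val_inj; exact: rel_mulUr.
- by move=> U V W; apply: val_inj; exact: rel_mulUl.
- move=> U V W; rewrite !lattice_le_G0; exact: rel_mul_imp.
Qed.
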